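(* Let $r \ge 2$ be an integer, let $\alpha \in \left( \frac{r-2}{r-1},\frac{r-1}{r} \right]$, and let $H$ be a fixed graph. Let $G_\alpha$ be a graph on $n$ vertices with $\delta(G_{\alpha}) \geq \alpha n$, and let $p = \omega\left(n^{-1/m^{(r)}(H)}\right)$. Then asymptotically almost surely the following holds: in the $(1:1)$ Waiter-Client game played on $G_\alpha \cup G_{n,p}$, Waiter has a strategy to force Client to claim a copy of $H$.
   Context: For a graph $H'$ let $d(H')=e(H')/v(H')$ and $m(H)=\max\{d(H'): H'\subseteq H,\ v(H')>0\}$ (maximum subgraph density). The $r$-partite density is $m^{(r)}(H)=\min_{V(H)=P_1\cup\dots\cup P_r}\max_i m(H[P_i])$, minimum over all partitions of $V(H)$ into $r$ parts. A $(1:1)$ Waiter-Client game: in each round Waiter offers two previously unchosen edges of the board (possibly one in the last round), Client claims one and Waiter gets the other; Waiter wins if Client claims all edges of a copy of $H$. $G_{n,p}$ is the binomial random graph on the vertex set of $G_\alpha$; $G_\alpha\cup G_{n,p}$ is the union of edge sets. A.a.s. means with probability tending to $1$ as $n\to\infty$. *)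

(* Defs.v *)
From HB Require Import structures.
From mathcomp Require Import all_boot all_order all_algebra.
From mathcomp Require Import all_classical all_reals all_analysis.

Set Implicit Arguments.
Unset Strict Implicit.
Unset Printing Implicit Defensive.

Import Order.TTheory GRing.Theory Num.Theory.
Import numFieldNormedType.Exports.

Local Open Scope ring_scope.

(* A finite simple graph with vertex set the whole type V. *)
Record sgraph (V : finType) := SGraph {
  edges :> {set {set V}};
  edgesP : edges \subset [set e : {set V} | #|e| == 2%N]
}.

HB.instance Definition _ (V : finType) := [isSub for @edges V].
HB.instance Definition _ (V : finType) := [Finite of sgraph V by <:].

Definition degree (V : finType) (G : sgraph V) (v : V) : nat :=
  #|[set e in edges G | v \in e]|.

(* The default #|V| exceeds every degree, so it only matters when V is empty. *)
Definition min_degree (V : finType) (G : sgraph V) : nat :=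
  \big[minn/#|V|]_(v : V) degree G v.

(* X = (vertices, edges) is a subgraph, not necessarily induced, of H[P]. *)
Definition subgraph_of_induced (T : finType) (H : sgraph T) (P : {set T})
    (X : {set T} * {set {set T}}) : bool :=
  [&& X.1 \subset P, X.2 \subset edges H & X.2 \subset powerset X.1].

(* m(H[P]); the default 0 makes this 0 when P is empty. *)
Definition max_density (R : realType) (T : finType) (H : sgraph T)
    (P : {set T}) : R :=
  \big[Num.max/0]_(X : {set T} * {set {set T}}
                     | subgraph_of_induced H P X && (0 < #|X.1|)%N)
    (#|X.2|%:R / #|X.1|%:R).

(* A partition into r possibly empty parts is given by the map f sending a
   vertex to the index of its part. The default m(H) bounds every term from
   above, so for 0 < r this is the minimum over all partitions. *)
Definition partite_density (R : realType) (T : finType) (r : nat)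
    (H : sgraph T) : R :=
  \big[Num.min/max_density R H [set: T]]_(f : {ffun T -> 'I_r})
    \big[Num.max/0]_(i < r) max_density R H [set v | f v == i].

(* n ^ (- 1 / m^(r)(H)), read as n ^ (- oo) = 0 when m^(r)(H) = 0. *)
Definition threshold (R : realType) (T : finType) (r : nat) (H : sgraph T)
    (n : nat) : R :=
  if partite_density R r H == 0 then 0
  else n%:R `^ (- (partite_density R r H)^-1).

Definition has_copy (T V : finType) (H : sgraph T) (C : {set {set V}}) : bool :=
  [exists f : {ffun T -> V},
     injectiveb f && [forall e in edges H, f @: e \in C]].

(* Positions of the (1:1) Waiter-Client game from which Waiter can force Client
   to claim a copy of H; F is the set of unchosen edges and C the set of edges
   claimed by Client. Since Client never loses edges, Waiter has won as soon as
   C contains a copy. A single edge may be offered only when it is the last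
   one, and Client then claims it. *)
Inductive waiter_forces (T V : finType) (H : sgraph T) :
    {set {set V}} -> {set {set V}} -> Prop :=
| Forced (F C : {set {set V}}) : has_copy H C -> waiter_forces H F C
| OfferTwo (F C : {set {set V}}) (e1 e2 : {set V}) :
    e1 \in F -> e2 \in F -> e1 != e2 ->
    waiter_forces H (F :\ e1 :\ e2) (e1 |: C) ->
    waiter_forces H (F :\ e1 :\ e2) (e2 |: C) ->
    waiter_forces H F C
| OfferLast (C : {set {set V}}) (e : {set V}) :
    waiter_forces H finset.set0 (e |: C) ->
    waiter_forces H [set e] C.

Definition waiter_wins (T V : finType) (H : sgraph T) (B : {set {set V}}) :
    Prop :=
  waiter_forces H B finset.set0.

(* The probability that the binomial random graph on V with edge probability p
   satisfies Q. *)
Definition gnp_prob (R : realType) (V : finType) (p : R)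
    (Q : sgraph V -> Prop) : R :=
  \sum_(E : sgraph V | `[< Q E >])
    p ^+ #|edges E| * (1 - p) ^+ ('C(#|V|, 2) - #|edges E|).

(* Main.v *)
(** Only containment is probabilistic: a board containing [2 ^ e(H)] disjoint
    copies of [H] is won by Waiter, who pairs up the copies and offers the same
    edge of two paired copies; half of the copies survive each round of pairing.
    Taking disjoint copies does not change [m^(r)], so it remains to find a fixed
    graph [H'] in [G_alpha] together with the random graph.  Fix an optimal
    [r]-partition of [H'].  The minimum degree gives a positive density of
    [r]-cliques, and duplicating vertices one at a time (Cauchy-Schwarz) gives a
    positive density of maps of [V(H')] whose bichromatic pairs are all edges of
    [G_alpha].  The second moment method over this dense family of maps supplies
    the monochromatic edges, all of whose subgraphs have density at most
    [m^(r)(H)]. *)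

Require Import Defs.
From mathcomp Require Import all_boot all_order all_algebra.
From mathcomp Require Import all_classical all_reals all_analysis.
From mathcomp Require Import zify ring lra.

Set Implicit Arguments.
Unset Strict Implicit.
Unset Printing Implicit Defensive.

Import Order.TTheory GRing.Theory Num.Theory.
Import numFieldNormedType.Exports.

Local Open Scope ring_scope.

(** * Parallel play on disjoint copies *)

(** Here [l] lists the edges of [H] still to be played and [L] the copies still alive. Playing one
    edge shortens [l] by one and keeps at least half of the paired copies, so [2 ^ size l] copies
    suffice. The second hypothesis keeps images apart, so that no offer spends an edge that another
    copy or a later edge needs. *)
Lemma waiter_forces_parallel (T V K : finType) (H : sgraph T)
    (h : K -> T -> V) (l : seq {set T}) (L : seq K) (F C : {set {set V}}) :
  (forall k, injective (h k)) ->
  (forall e e' : {set T}, e \in edges H -> e' \in edges H ->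
     forall k k', h k @: e = h k' @: e' -> k = k' /\ e = e') ->
  uniq l -> uniq L -> {subset l <= edges H} -> (2 ^ size l <= size L)%N ->
  {in L, forall k, {in l, forall e : {set T}, h k @: e \in F}} ->
  {in L, forall k, {in edges H, forall e : {set T}, e \notin l -> h k @: e \in C}} ->
  waiter_forces H F C.
Proof.
move=> hinj himg; elim: l L F C => [|e l IH] L F C.
  move=> _ _ _; case: L => // k L _ _ hC; apply: Forced.
  apply/existsP; exists [ffun t => h k t]; apply/andP; split.
    by apply/injectiveP => x y; rewrite !ffunE; apply: hinj.
  apply/forallP => e; apply/implyP => eH.
  rewrite (eq_imset (g := h k)); last by move=> t; rewrite ffunE.
  by apply: hC => //; rewrite mem_head.
move=> /= /andP[el ul] uL sl szL hF hC.
have eH : e \in edges H by apply: sl; rewrite mem_head.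
have lH : {subset l <= edges H} by move=> x xl; apply: sl; rewrite inE xl orbT.
(* [L1] lists the copies whose edge [e] is still free, [L2] those in which
   Client has already claimed it. *)
suff main : forall (n : nat) (L1 L2 : seq K) (F C : {set {set V}}), (size L1 <= n)%N ->
    uniq (L1 ++ L2) -> (2 ^ (size l).+1 <= size L1 + (size L2).*2)%N ->
    {in L1, forall k, h k @: e \in F} ->
    {in L1 ++ L2, forall k, {in l, forall e : {set T}, h k @: e \in F}} ->
    {in L2, forall k, h k @: e \in C} ->
    {in L1 ++ L2, forall k, {in edges H, forall e' : {set T}, e' \notin e :: l ->
       h k @: e' \in C}} ->
    waiter_forces H F C.
  apply: (main (size L) L [::]); rewrite ?cats0 ?addn0 //.
  - by move=> k kL; apply: hF; rewrite ?mem_head.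
  - by move=> k kL e' e'l; apply: hF; rewrite // inE e'l orbT.
elim=> [|n IHn] L1 L2 {}F {}C {hF hC uL szL L}.
  rewrite leqn0 => /nilP -> /= uL szL _ hF heC hC.
  apply: (IH L2) => //; first by rewrite expnS in szL; lia.
  move=> k kL e' e'H e'l; have [->|ne] := eqVneq e' e; first exact: heC.
  by apply: hC => //; rewrite inE negb_or ne.
case: L1 => [|a [|b L1]] szn uL szL heF hF heC hC.
- by apply: (IHn [::] L2).
(* A single unpaired copy is dropped. The bound survives by parity: [2 ^ (size l).+1] and
   [(size L2).*2] are both even. *)
- apply: (IHn [::] L2) => //.
  + by case/andP: uL.
  + by move: szL; rewrite expnS /=; lia.
  + by move=> k kL; apply: hF; rewrite inE kL orbT.
  + by move=> k kL; apply: hC; rewrite inE kL orbT.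
move: (uL); rewrite /= inE negb_or => /and3P[/andP[ab aN] bN uN].
pose F' := F :\ (h a @: e) :\ (h b @: e).
(* Client's choice keeps the copy [c] and kills the other one. Two copies leave [L1] and one enters
   [L2], so [size L1 + (size L2).*2] is unchanged. *)
have step c (C' : {set {set V}}) : c \in [:: a; b] -> C' = (h c @: e) |: C ->
    waiter_forces H F' C'.
  move=> cab ->; apply: (IHn L1 (c :: L2)).
  - by move: szn => /=; lia.
  - rewrite -(cat1s c) uniq_catCA /= uN andbT.
    by move: cab; rewrite !inE => /orP[] /eqP ->.
  - by move: szL => /=; lia.
  - move=> k kL; rewrite !inE heF ?inE ?kL ?orbT // andbT.
    have kab : (k != a) && (k != b).
      move: aN bN; rewrite !mem_cat !negb_or => /andP[aL _] /andP[bL _].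
      by apply/andP; split; [apply: contraNneq aL|apply: contraNneq bL] => <-.
    apply/andP; split; apply/eqP => /(himg _ _ eH eH) [kk _];
      by rewrite kk eqxx ?andbF in kab.
  - move=> k kL e' e'l; rewrite !inE.
    have e'e : e' != e by apply: contraNneq el => <-.
    have kL' : k \in [:: a, b & L1] ++ L2.
      move: kL cab; rewrite !(inE, mem_cat) => /or3P[->|/eqP->|->];
        by rewrite ?orbT // => /orP[] ->; rewrite ?orbT.
    rewrite (hF _ kL' _ e'l) andbT.
    by apply/andP; split; apply/eqP => /(himg _ _ (lH _ e'l) eH) [_ ee];
      rewrite ee eqxx in e'e.
  - move=> k; rewrite !inE => /predU1P[->|kL]; first by rewrite eqxx.
    by rewrite heC ?orbT.
  - move=> k kL e' e'H e'l; rewrite !inE hC ?orbT //.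
    move: kL cab; rewrite !(inE, mem_cat) => /or3P[->|/eqP->|->];
      by rewrite ?orbT // => /orP[] ->; rewrite ?orbT.
apply: (@OfferTwo _ _ _ _ _ (h a @: e) (h b @: e)).
- by apply: heF; rewrite inE eqxx.
- by apply: heF; rewrite !inE eqxx orbT.
- by apply/eqP => /(himg _ _ eH eH) [] /eqP; rewrite (negPf ab).
- by apply: (step a) => //; rewrite inE eqxx.
- by apply: (step b) => //; rewrite !inE eqxx orbT.
Qed.

(** The disjoint union of copies of [H] indexed by [K], the [H'] of the outline when [K] has
    [2 ^ e(H)] elements. *)
Definition copies_edges (T K : finType) (H : sgraph T) : {set {set K * T}} :=
  [set pair u.1 @: (u.2 : {set T}) | u in finset.setX [set: K] (edges H)].

Lemma edge_neq0 (T : finType) (H : sgraph T) (e : {set T}) :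
  e \in edges H -> exists t, t \in e.
Proof.
move=> /(fintype.subsetP (edgesP H)); rewrite inE => /eqP e2.
by apply/set0Pn; rewrite -card_gt0 e2.
Qed.

Lemma waiter_wins_copies (T V : finType) (H : sgraph T) (B : {set {set V}})
    (g : 'I_(2 ^ #|edges H|) * T -> V) :
  injective g -> {in copies_edges _ H, forall e : {set _}, g @: e \in B} ->
  waiter_wins H B.
Proof.
move=> ginj gB; pose h k t := g (k, t).
have hE k (e : {set T}) : h k @: e = g @: (pair k @: e).
  exact: (imset_comp g (pair k) e).
apply: (@waiter_forces_parallel _ _ _ H h (enum (edges H)) (enum 'I__)).
- by move=> k s t /ginj[].
- move=> e e' eH e'H k k'; rewrite !hE => /(imset_inj ginj) kk.
  (* Edges are nonempty, so a vertex of the image reveals which copy it belongs to. *)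
  have [t te] := edge_neq0 eH.
  have : (k, t) \in pair k' @: e' by rewrite -kk imset_f.
  case/imsetP => _ _ [k'k _]; move: kk; rewrite -k'k.
  have pinj : injective (pair k : T -> _ * T) by move=> x y [].
  by move/(imset_inj pinj) => ->.
- exact: enum_uniq.
- exact: enum_uniq.
- by move=> e; rewrite mem_enum.
- by rewrite -!cardE card_ord.
- move=> k _ e; rewrite mem_enum hE => eH; apply: gB.
  by apply/imsetP; exists (k, e); rewrite ?inE.
- by move=> k _ e; rewrite mem_enum => ->.
Qed.

(** * Density of complete multipartite maps *)

Definition ffun_upd {A : finType} {B : Type} (x : {ffun A -> B}) (a : A) (v : B) :
  {ffun A -> B} := [ffun b => if b == a then v else x b].

Lemma ffun_upd_same (A : finType) (B : Type) (x : {ffun A -> B}) a v :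
  ffun_upd x a v a = v.
Proof. by rewrite ffunE eqxx. Qed.

Lemma ffun_upd_neq (A : finType) (B : Type) (x : {ffun A -> B}) a v b :
  b != a -> ffun_upd x a v b = x b.
Proof. by rewrite ffunE => /negPf ->. Qed.

Lemma ffun_upd_upd (A : finType) (B : Type) (x : {ffun A -> B}) a v w :
  ffun_upd (ffun_upd x a v) a w = ffun_upd x a w.
Proof. by apply/ffunP => b; rewrite !ffunE; case: eqP. Qed.

(* [(x, v) |-> (x with a := v, x a)] is an involution. *)
Lemma sum_ffun_upd (R : pzRingType) (A V : finType) (a : A)
    (g : {ffun A -> V} -> R) :
  \sum_x \sum_v g (ffun_upd x a v) = #|V|%:R * \sum_x g x.
Proof.
pose s (u : {ffun A -> V} * V) := (ffun_upd u.1 a u.2, u.1 a).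
have sK : involutive s.
  case=> x v; rewrite /s /= ffun_upd_same ffun_upd_upd; congr pair.
  by apply/ffunP => b; rewrite ffunE; case: eqP => // ->.
rewrite pair_bigA /= -[LHS]/(\sum_u g (s u).1).
rewrite (reindex_inj (inv_inj sK)) (eq_bigr (fun u => g u.1)); last first.
  by move=> u _; rewrite sK.
rewrite -(pair_bigA _ (fun x v => g x)) /= mulr_sumr.
by apply: eq_bigr => x _; rewrite sumr_const mulr_natl.
Qed.

(** Cauchy-Schwarz against the constant function, read off from [0 <= \sum_a (n * y a - S) ^+ 2]. *)
Lemma sum_sqr_le (R : realFieldType) (A : finType) (y : A -> R) :
  (\sum_a y a) ^+ 2 <= #|A|%:R * \sum_a y a ^+ 2.
Proof.
have [A0|A0] := posnP #|A|.
  by rewrite A0 mul0r big1 ?expr0n // => a; have := fintype0 a A0.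
set S := \sum_a y a; set n : R := #|A|%:R.
have n0 : 0 < n by rewrite ltr0n.
have hc : \sum_(a : A) S ^+ 2 = n * S ^+ 2 by rewrite sumr_const mulr_natl.
have : 0 <= \sum_a (n * y a - S) ^+ 2 by apply: sumr_ge0 => a _; apply: sqr_ge0.
rewrite (eq_bigr (fun a => n ^+ 2 * y a ^+ 2 - (2 * n * S) * y a + S ^+ 2)); last first.
  by move=> a _; ring.
rewrite big_split /= sumrB hc -!mulr_sumr -/S => h.
rewrite -subr_ge0 -(pmulr_rge0 _ n0); apply: le_trans h _.
by rewrite le_eqVlt; apply/orP; left; apply/eqP; ring.
Qed.

Definition nonadjacent {V : finType} (adj : rel V) (v : V) : {set V} :=
  [set w | ~~ adj v w].

Definition prefix_clique {V : finType} (adj : rel V) (r k : nat)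
    (x : {ffun 'I_r -> V}) : bool :=
  [forall i : 'I_r, forall j : 'I_r, (i < j < k)%N ==> adj (x i) (x j)].

(** Greedy extension: at most [r.-1] earlier vertices each exclude at most [b * #|V|] candidates,
    which leaves at least [d * #|V|] choices for the next one. Coordinates from [k] on stay free, so
    every stage is counted among all of [V ^ r]. *)
Lemma prefix_clique_density (R : realFieldType) (V : finType) (adj : rel V)
    (r k : nat) (b d : R) :
  (0 < #|V|)%N -> (forall v, #|nonadjacent adj v|%:R <= b * #|V|%:R) ->
  0 <= b -> 0 <= d -> d <= 1 - r.-1%:R * b -> (k <= r)%N ->
  d ^+ k * #|V|%:R ^+ r <= \sum_(x : {ffun 'I_r -> V}) (prefix_clique adj k x)%:R.
Proof.
move=> V0 hb b0 d0 hd; elim: k => [_|k IH kr].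
  rewrite expr0 mul1r (eq_bigr (fun=> 1)); last first.
    move=> x _; rewrite /prefix_clique (_ : [forall i, _]) //.
    by apply/forallP => i; apply/forallP => j; rewrite ltn0 andbF.
  by rewrite sumr_const card_ffun card_ord natrX.
have n0 : 0 < #|V|%:R :> R by rewrite ltr0n.
(* The extra factor [#|V|] pays for resampling coordinate [k], on which [prefix_clique adj k] does
   not depend. *)
rewrite -(ler_pM2l n0) -(sum_ffun_upd (Ordinal kr)).
apply: le_trans (_ : \sum_(x : {ffun 'I_r -> V}) (prefix_clique adj k x)%:R * (d * #|V|%:R) <= _).
  rewrite -mulr_suml exprS [leRHS]mulrC.
  rewrite [leLHS](_ : _ = d * #|V|%:R * (d ^+ k * #|V|%:R ^+ r)); last by ring.
  by apply: ler_wpM2l (IH (ltnW kr)); rewrite mulr_ge0 // ltW.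
apply: ler_sum => x _; case: (boolP (prefix_clique adj k x)) => [px|_]; last first.
  by rewrite mul0r; apply: sumr_ge0 => v _; apply: ler0n.
rewrite mul1r; pose bad := \bigcup_(i : 'I_r | (i < k)%N) nonadjacent adj (x i).
have hbad : #|bad|%:R <= r.-1%:R * b * #|V|%:R :> R.
  have : (#|bad| <= \sum_(i : 'I_r | (i < k)%N) #|nonadjacent adj (x i)|)%N.
    rewrite /bad; elim/big_ind2: _ => [|m A m' A' hA hA'|//]; first by rewrite cards0.
    by rewrite (leq_trans (leq_card_setU _ _)) // leq_add.
  rewrite -(ler_nat R) natr_sum => /le_trans; apply.
  apply: le_trans (ler_sum _ (fun i _ => hb (x i))) _.
  rewrite sumr_const -mulrA -[leLHS]mulr_natl; apply: ler_wpM2r.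
    by rewrite mulr_ge0 // ltW.
  rewrite ler_nat; apply: (@leq_trans k); last by lia.
  by rewrite -sum1_card (big_ord_narrow (ltnW kr)) sum1_card card_ord.
apply: (@le_trans _ _ (\sum_v (v \notin bad)%:R)).
  rewrite -natr_sum -big_mkcond /= sum1_card.
  rewrite [X in _ <= X%:R](_ : _ = #|~: bad|); last first.
    by apply: eq_card => v; rewrite inE.
  rewrite cardsCs finset.setCK natrB ?max_card //.
  apply: le_trans (ler_wpM2r (ltW n0) hd) _.
  by rewrite mulrBl mul1r lerD2l lerN2.
apply: ler_sum => v _; have [vbad|vbad] := boolP (v \in bad); first by rewrite ler0n.
suff -> : prefix_clique adj k.+1 (ffun_upd x (Ordinal kr) v) by [].
apply/forallP => i; apply/forallP => j; apply/implyP => /andP[ij].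
rewrite ltnS leq_eqVlt => /orP[/eqP jk|jk].
  have -> : j = Ordinal kr by apply: val_inj.
  have ik : i != Ordinal kr by rewrite -val_eqE /= -jk neq_ltn ij.
  rewrite ffun_upd_same ffun_upd_neq //; apply: contraNT vbad => nadj.
  by apply/bigcupP; exists i; rewrite ?inE // -jk.
have := forallP (forallP px i) j; rewrite ij jk /=.
by rewrite !ffun_upd_neq // -val_eqE /= neq_ltn ?jk ?(ltn_trans ij).
Qed.

(** These are the homomorphisms from the complete multipartite graph whose parts are the fibres of
    [f]; they may fail to be injective. *)
Definition partite_hom {Z V : finType} (r : nat) (f : Z -> 'I_r) (adj : rel V)
    (phi : {ffun Z -> V}) : bool :=
  [forall y, forall z, (f y != f z) ==> adj (phi y) (phi z)].

(* For [z] in [s], [phi z] can replace the vertex of colour [f z] in the clique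
   [x]; both [x] and the unconstrained part of [phi] are kept so that every stage
   is measured on the same space. *)
Definition blowup_upto {Z V : finType} (r : nat) (f : Z -> 'I_r) (adj : rel V)
    (s : seq Z) (u : {ffun 'I_r -> V} * {ffun Z -> V}) : bool :=
  [&& [forall i, forall j, (i != j) ==> adj (u.1 i) (u.1 j)],
      all (fun z => [forall j, (f z != j) ==> adj (u.2 z) (u.1 j)]) s &
      allrel (fun y z => (f y != f z) ==> adj (u.2 y) (u.2 z)) s s].

(** If [phi z] can stand in for the clique vertex [x (f z)], then it is adjacent to the other clique
    vertices and to every [phi y] of another colour, which is all that adding [z] demands. *)
Lemma blowup_upto_cons (Z V : finType) (r : nat) (f : Z -> 'I_r) (adj : rel V)
    (z : Z) (s : seq Z) x phi :
  symmetric adj -> blowup_upto f adj s (x, phi) ->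
  blowup_upto f adj s (ffun_upd x (f z) (phi z), phi) ->
  blowup_upto f adj (z :: s) (x, phi).
Proof.
move=> sadj /and3P[/= xx zx zz] /and3P[/= xx' zx' zz'].
have zxj j : f z != j -> adj (phi z) (x j).
  move=> zj; have := forallP (forallP xx' (f z)) j; rewrite zj /=.
  by rewrite ffun_upd_same ffun_upd_neq // eq_sym.
have zs y : y \in s -> f z != f y -> adj (phi z) (phi y).
  move=> ys zy; have := forallP (allP zx' _ ys) (f z).
  by rewrite eq_sym zy ffun_upd_same sadj.
apply/and3P; split=> //=.
  by rewrite zx andbT; apply/forallP => j; apply/implyP; apply: zxj.
rewrite allrel_consl allrel_consr /= zz (eqxx (f z)) andbT /=.
by apply/andP; split; apply/allP => y ys; apply/implyP => zy;
  [apply: zs|rewrite sadj; apply: zs => //; rewrite eq_sym].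
Qed.

Lemma blowup_upto_updr (Z V : finType) (r : nat) (f : Z -> 'I_r) (adj : rel V)
    (z : Z) (s : seq Z) x phi v :
  z \notin s ->
  blowup_upto f adj s (x, ffun_upd phi z v) = blowup_upto f adj s (x, phi).
Proof.
move=> zs; have sE y : y \in s -> ffun_upd phi z v y = phi y.
  by move=> ys; rewrite ffun_upd_neq //; apply: contraNneq zs => <-.
rewrite /blowup_upto /=; congr [&& _, _ & _].
  by apply: eq_in_all => y ys; rewrite sE.
apply: eq_in_all => y ys; apply: eq_in_all => y' ys'; rewrite !sE //.
Qed.

(** Duplicating one clique vertex squares the density at worst, by Cauchy-Schwarz; hence the
    exponent [2 ^ size s]. *)
Lemma blowup_upto_density (R : realFieldType) (Z V : finType) (r : nat)
    (f : Z -> 'I_r) (adj : rel V) (s : seq Z) (c : R) :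
  symmetric adj -> (0 < #|V|)%N -> 0 <= c -> uniq s ->
  c * #|V|%:R ^+ r * #|V|%:R ^+ #|Z| <= \sum_u (blowup_upto f adj [::] u)%:R ->
  c ^+ (2 ^ size s) * #|V|%:R ^+ r * #|V|%:R ^+ #|Z|
    <= \sum_u (blowup_upto f adj s u)%:R.
Proof.
move=> sadj V0 c0; elim: s => [|z s IH] //= /andP[zs us] h0.
have {IH h0} := IH us h0; set N : R := \sum_u _ => hN.
have n0 : 0 < #|V|%:R :> R by rewrite ltr0n.
set n : R := #|V|%:R in hN n0 *; set W : R := n ^+ r * n ^+ #|Z|.
have W0 : 0 < W by rewrite mulr_gt0 // exprn_gt0.
pose E u : R := (blowup_upto f adj s u)%:R.
(* [y u] counts the vertices admissible in the slot [f z]. Its square counts pairs of them, one to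
   stay in the clique and one to become [phi z]. *)
pose y (u : {ffun 'I_r -> V} * {ffun Z -> V}) := \sum_v E (ffun_upd u.1 (f z) v, u.2).
have sumy : \sum_u y u = n * N.
  rewrite /y /N -(pair_bigA _ (fun x phi => \sum_v E (ffun_upd x (f z) v, phi))) /=.
  rewrite -(pair_bigA _ (fun x phi => E (x, phi))) /=.
  rewrite exchange_big [in RHS]exchange_big /= mulr_sumr.
  by apply: eq_bigr => phi _; rewrite (sum_ffun_upd (f z) (fun x => E (x, phi))).
have cardW : #|{: {ffun 'I_r -> V} * {ffun Z -> V}}|%:R = W :> R.
  by rewrite card_prod !card_ffun card_ord natrM !natrX.
have step : \sum_u y u ^+ 2 <= n ^+ 2 * \sum_u (blowup_upto f adj (z :: s) u)%:R.
  apply: le_trans (_ : n ^+ 2 * (\sum_x \sum_phi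
      E (x, phi) * E (ffun_upd x (f z) (phi z), phi)) <= _); last first.
    apply: ler_wpM2l; first exact/exprn_ge0/ltW.
    rewrite pair_bigA /=; apply: ler_sum => -[x phi] _ /=; rewrite /E.
    case: (boolP (blowup_upto _ _ s (x, _))) => [h1|]; last by rewrite mul0r.
    case: (boolP (blowup_upto _ _ s _)) => [h2|]; last by rewrite mulr0.
    by rewrite blowup_upto_cons // mulr1.
  (* The factor [n ^+ 2] pays for two resamplings: [phi z] becomes [w], which [E] does not see since
     [z \notin s], and [x (f z)] becomes [v]. The resulting double sum over [v] and [w] is
     [y u ^+ 2]. *)
  rewrite expr2 -mulrA mulr_sumr.
  under [X in _ <= _ * X]eq_bigr => x _.
    rewrite -(sum_ffun_upd z (fun phi => E (x, phi) * E (ffun_upd x (f z) (phi z), phi))).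
    under eq_bigr => phi _.
      under eq_bigr => w _ do rewrite /E ffun_upd_same !blowup_upto_updr //.
      over.
    over.
  rewrite -(sum_ffun_upd (f z)) -(pair_bigA _ (fun x phi => y (x, phi) ^+ 2)) /=.
  rewrite le_eqVlt; apply/orP; left; apply/eqP; apply: eq_bigr => x _.
  rewrite [RHS]exchange_big /=; apply: eq_bigr => phi _.
  rewrite expr2 {1}/y mulr_suml; apply: eq_bigr => v _.
  rewrite /y mulr_sumr; apply: eq_bigr => w _.
  by rewrite /= ffun_upd_upd.
have CS := sum_sqr_le y; rewrite sumy cardW in CS.
have : (n * N) ^+ 2 <= W * (n ^+ 2 * \sum_u (blowup_upto f adj (z :: s) u)%:R).
  by apply: le_trans CS _; rewrite ler_pM2l.
rewrite exprMn [leRHS]mulrCA ler_pM2l ?exprn_gt0 // => h.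
rewrite -mulrA -/W -(ler_pM2l W0); apply: le_trans h.
rewrite (_ : W * _ = (c ^+ (2 ^ size s) * W) ^+ 2); last first.
  by rewrite expnS mulnC exprM; ring.
have cW : c ^+ (2 ^ size s) * W <= N by rewrite /W mulrA.
have cW0 : 0 <= c ^+ (2 ^ size s) * W by rewrite mulr_ge0 ?exprn_ge0 // ltW.
by rewrite ler_pXn2r // nnegrE (le_trans cW0).
Qed.

Lemma partite_hom_density (R : realFieldType) (Z V : finType) (r : nat)
    (f : Z -> 'I_r) (adj : rel V) (b d : R) :
  symmetric adj -> (0 < #|V|)%N ->
  (forall v, #|nonadjacent adj v|%:R <= b * #|V|%:R) ->
  0 <= b -> 0 <= d -> d <= 1 - r.-1%:R * b ->
  (d ^+ r) ^+ (2 ^ #|Z|) * #|V|%:R ^+ #|Z|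
    <= \sum_(phi : {ffun Z -> V}) (partite_hom f adj phi)%:R.
Proof.
move=> sadj V0 hb b0 d0 hd.
have n0 : 0 < #|V|%:R :> R by rewrite ltr0n.
have nr0 : 0 < #|V|%:R ^+ r :> R by rewrite exprn_gt0.
have nZ0 : 0 < #|V|%:R ^+ #|Z| :> R by rewrite exprn_gt0.
have := @blowup_upto_density R Z V r f adj (enum Z) (d ^+ r) sadj V0 _ (enum_uniq _).
rewrite -cardE => /(_ (exprn_ge0 _ d0)) H; rewrite -(ler_pM2l nr0).
apply: le_trans (_ : \sum_u (blowup_upto f adj (enum Z) u)%:R <= _).
  rewrite [leLHS]mulrA (mulrC (_ ^+ r)); apply: H.
  rewrite -(pair_bigA _ (fun x phi => (blowup_upto f adj [::] (x, phi))%:R)) /=.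
  apply: le_trans (ler_wpM2r (ltW nZ0) (prefix_clique_density V0 hb b0 d0 hd (leqnn r))) _.
  rewrite mulr_suml; apply: ler_sum => x _.
  rewrite -natrX -card_ffun mulr_natr -sumr_const; apply: ler_sum => phi _.
  case: (boolP (prefix_clique _ _ _)) => // cx; rewrite ler_nat lt0b.
  apply/and3P; split=> //; apply/forallP => i; apply/forallP => j; apply/implyP => /=.
  have {}cx (i' j' : 'I_r) : (i' < j')%N -> adj (x i') (x j').
    by move=> ij; have := forallP (forallP cx i') j'; rewrite ij ltn_ord.
  by rewrite -val_eqE neq_ltn => /orP[/cx|/cx] //; rewrite sadj.
rewrite -(pair_bigA _ (fun x phi => (blowup_upto f adj (enum Z) (x, phi))%:R)) /=.
rewrite exchange_big mulr_sumr /=; apply: ler_sum => phi _.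
(* Forgetting the clique costs a factor of at most [#|V| ^ r]: each homomorphism is counted at most
   once for every [x]. *)
case: (boolP (partite_hom f adj phi)) => [_|nh].
  rewrite mulr1 -natrX -[X in (X ^ _)%N]card_ord.
  apply: le_trans (_ : \sum_(x : {ffun 'I_r -> V}) 1%:R <= _).
    by apply: ler_sum => x _; rewrite ler_nat leq_b1.
  by rewrite sumr_const card_ffun !card_ord.
rewrite mulr0 big1 // => x _; apply/eqP; rewrite pnatr_eq0 eqb0.
apply: contra nh => /and3P[_ _ /allrelP zz].
by apply/forallP => y; apply/forallP => z; apply: zz; rewrite mem_enum.
Qed.

(** Union bound over ordered pairs [a], [b]: when [phi a] is resampled, exactly one value collides
    with [phi b]. *)
Lemma sum_noninjective (R : realFieldType) (Z V : finType) : (0 < #|V|)%N ->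
  #|V|%:R * \sum_(phi : {ffun Z -> V}) (~~ injectiveb phi)%:R
    <= #|Z|%:R ^+ 2 * #|V|%:R ^+ #|Z| :> R.
Proof.
move=> V0; pose coll (phi : {ffun Z -> V}) a b : R := ((a != b) && (phi a == phi b))%:R.
apply: le_trans (_ : #|V|%:R * \sum_phi \sum_a \sum_b coll phi a b <= _).
  apply: ler_wpM2l => //; apply: ler_sum => phi _.
  have coll0 a b : 0 <= coll phi a b by apply: ler0n.
  case: (boolP (injectiveb phi)) => [_|/injectivePn[a [b ab eab]]].
    by apply: sumr_ge0 => a _; apply: sumr_ge0.
  rewrite (bigD1 a) //= (bigD1 b) //= {1}/coll ab eab eqxx /= -addrA lerDl.
  by apply: addr_ge0; apply: sumr_ge0 => // ? _; apply: sumr_ge0.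
have sumc (A : finType) (c : R) : #|A|%:R * c = \sum_(a : A) c.
  by rewrite sumr_const mulr_natl.
rewrite exchange_big mulr_sumr expr2 -mulrA [leRHS]sumc /=.
apply: ler_sum => a _.
rewrite exchange_big mulr_sumr [leRHS]sumc /=; apply: ler_sum => b _.
have [->|ab] := eqVneq a b.
  by rewrite big1 ?mulr0 ?exprn_ge0 // => phi _; rewrite /coll eqxx.
rewrite -(sum_ffun_upd a (fun phi => coll phi a b)) -natrX -card_ffun -[leRHS]mulr1 sumc.
apply: ler_sum => phi _; rewrite (bigD1 (phi b)) //= big1 => [|v vb].
  by rewrite addr0 /coll lern1 leq_b1.
have ba : b != a by rewrite eq_sym.
by rewrite /coll ab ffun_upd_same ffun_upd_neq // (negPf vb).
Qed.

(** * Second moment method *)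

Definition gnp_weight {R : realType} {V : finType} (p : R) (E : sgraph V) : R :=
  p ^+ #|edges E| * (1 - p) ^+ ('C(#|V|, 2) - #|edges E|).

Definition all_edges (V : finType) : {set {set V}} := [set e : {set V} | #|e| == 2%N].

(** Independence of the edges, by expanding [\prod_e (F e + G e)], where [F e] is the weight of
    taking [e] and [G e] that of leaving it out. [G] vanishes on [S] and [F] off the two-element
    sets, so only the edge sets of graphs containing [S] survive. *)
Lemma gnp_weight_superset (R : realType) (V : finType) (p : R) (S : {set {set V}}) :
  S \subset all_edges V ->
  \sum_(E : sgraph V | S \subset edges E) gnp_weight p E = p ^+ #|S|.
Proof.
move=> SD; set D := all_edges V in SD *.
pose F (e : {set V}) : R := if e \in D then p else 0.
pose G (e : {set V}) : R := if e \in S then 0 else if e \in D then 1 - p else 1.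
transitivity (\prod_e (F e + G e)); last first.
  rewrite -prodr_const [RHS]big_mkcond /=; apply: eq_bigr => e _.
  rewrite /F /G; have [eS|eS] := boolP (e \in S).
    by rewrite (fintype.subsetP SD) // addr0.
  by case: ifP => _; rewrite ?add0r // addrC subrK.
rewrite bigA_distr /=.
rewrite (bigID (fun J : {set {set V}} => (S \subset J) && (J \subset D))) /=.
rewrite [X in _ + X]big1 ?addr0; last first.
  move=> J; rewrite negb_and => /orP[/fintype.subsetPn[e eS eJ]|/fintype.subsetPn[e eJ eD]].
    by rewrite (bigD1 e) //= (negPf eJ) /G eS mul0r.
  by rewrite (bigD1 e) //= eJ /F (negPf eD) mul0r.
symmetry; rewrite (reindex_omap (@edges V) insub); last first.
  by move=> J /andP[_ JD]; rewrite insubT.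
apply: eq_big => [E|E /andP[/andP[SE ED] _]].
  by rewrite valK eqxx andbT (edgesP E) andbT.
rewrite (bigID (mem (edges E))) /= /gnp_weight; congr (_ * _).
  rewrite -prodr_const; apply: eq_bigr => e eE.
  by rewrite eE /F (fintype.subsetP ED).
have <- : #|D| = 'C(#|V|, 2) by rewrite -card_draws; apply: eq_card => e; rewrite !inE.
rewrite -cardsDS // -prodr_const big_mkcond [RHS]big_mkcond /=.
apply: eq_bigr => e _; rewrite inE.
case: (boolP (e \in edges E)) => //= eE.
by rewrite /G (negPf (contra (fintype.subsetP SE e) eE)).
Qed.

Lemma gnp_weight_ge0 (R : realType) (V : finType) (p : R) (E : sgraph V) :
  0 <= p <= 1 -> 0 <= gnp_weight p E.
Proof.
by case/andP => p0 p1; rewrite mulr_ge0 // exprn_ge0 // subr_ge0.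
Qed.

Lemma gnp_weight_total (R : realType) (V : finType) (p : R) :
  \sum_(E : sgraph V) gnp_weight p E = 1.
Proof.
rewrite -(expr0 p) -(cards0 {set V}) -gnp_weight_superset ?finset.sub0set //.
by apply: eq_bigl => E; rewrite finset.sub0set.
Qed.

Lemma gnp_prob_le1 (R : realType) (V : finType) (p : R) Q :
  0 <= p <= 1 -> gnp_prob (V := V) p Q <= 1.
Proof.
move=> p01; rewrite -(@gnp_weight_total R V p) [leRHS](bigID (fun E => `[< Q E >])) /=.
by rewrite lerDl sumr_ge0 // => E _; apply: gnp_weight_ge0.
Qed.

(** The count factorises over [z]: with the weight, a point of [B] contributes [#|V| * #|C|] and any
    other point [#|V|]. As [1 <= k], a factor [k] may be granted to every point. *)
Lemma weighted_count_ffun_into (R : realFieldType) (Z V : finType) (B : {set Z})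
    (C : {set V}) (k : R) :
  #|C|%:R <= k -> 1 <= k ->
  #|V|%:R ^+ #|B| * \sum_(psi : {ffun Z -> V}) [forall z in B, psi z \in C]%:R
    <= k ^+ #|Z| * #|V|%:R ^+ #|Z|.
Proof.
move=> Ck k1; have k0 : 0 <= k by apply: le_trans k1.
have -> : \sum_(psi : {ffun Z -> V}) [forall z in B, psi z \in C]%:R =
    \sum_(psi : {ffun Z -> V}) \prod_z (((z \in B) ==> (psi z \in C))%:R : R).
  apply: eq_bigr => psi _; case: (boolP [forall z in B, _]) => [/forallP h|].
    by rewrite big1 // => z _; rewrite h.
  by rewrite negb_forall => /existsP[z hz]; rewrite (bigD1 z) //= (negPf hz) mul0r.
rewrite -(bigA_distr_bigA (fun z v => ((z \in B) ==> (v \in C))%:R)) /=.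
rewrite -prodr_const big_mkcond -big_split /= -exprMn -(prodr_const (mem Z)).
apply: ler_prod => z _; apply/andP; split.
  by rewrite mulr_ge0 ?sumr_ge0 //; case: ifP.
case: ifP => zB /=; rewrite -natr_sum.
  rewrite -big_mkcond sum1_card mulrC ler_wpM2r //.
by rewrite sum1_card mul1r ler_peMl.
Qed.

Definition edge_image {Z V : finType} (E0 : {set {set Z}}) (phi : {ffun Z -> V}) :
  {set {set V}} := [set phi @: (e : {set Z}) | e in E0].

Lemma card_edge_image (Z V : finType) (E0 : {set {set Z}}) (phi : {ffun Z -> V}) :
  injective phi -> #|edge_image E0 phi| = #|E0|.
Proof. by move=> phi_inj; rewrite card_imset //; apply: imset_inj. Qed.

Lemma edge_image_sub (Z V : finType) (E0 : {set {set Z}}) (phi : {ffun Z -> V}) :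
  injective phi -> E0 \subset all_edges Z -> edge_image E0 phi \subset all_edges V.
Proof.
move=> phi_inj /fintype.subsetP h; apply/fintype.subsetP => _ /imsetP[e /h eZ ->].
by move: eZ; rewrite !inE card_imset.
Qed.

(** If [J] is the set of edges whose image under [psi] is shared with [phi], the union has
    [2 * #|E0| - #|J|] edges, and the last hypothesis bounds the gain [p ^- #|J|] by
    [eps * #|V| ^ #|cover J|]. Summing over all [J], with the indicator that [psi] sends the cover
    into the image of [phi], makes the bound easy to sum over [psi]. *)
Lemma edge_image_overlap (R : realFieldType) (Z V : finType) (E0 : {set {set Z}})
    (phi psi : {ffun Z -> V}) (p eps : R) :
  injective phi -> injective psi -> 0 <= p -> 0 <= eps ->
  (forall J : {set {set Z}}, J \subset E0 -> J != finset.set0 ->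
     1 <= eps * #|V|%:R ^+ #|finset.cover J| * p ^+ #|J|) ->
  p ^+ #|edge_image E0 phi :|: edge_image E0 psi| <=
    p ^+ (2 * #|E0|) + \sum_(J : {set {set Z}})
      p ^+ (2 * #|E0|) * eps *
      (#|V|%:R ^+ #|finset.cover J| *
       [forall z in finset.cover J, psi z \in [set phi z | z : Z]]%:R).
Proof.
move=> phi_inj psi_inj p0 eps0 hJ.
pose J := [set e in E0 | psi @: (e : {set Z}) \in edge_image E0 phi].
have JE : J \subset E0 by apply/fintype.subsetP => e; rewrite inE => /andP[].
have cardI : #|edge_image E0 phi :&: edge_image E0 psi| = #|J|.
  rewrite -(card_edge_image J psi_inj); apply: eq_card => x; rewrite inE.
  apply/andP/imsetP => [[xp /imsetP[e eE xe]]|[e]].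
    by exists e => //; rewrite inE eE -xe.
  by rewrite inE => /andP[eE h] ->; rewrite h imset_f.
have cardU : #|edge_image E0 phi :|: edge_image E0 psi| = (2 * #|E0| - #|J|)%N.
  by rewrite cardsU cardI !card_edge_image // mul2n addnn.
have t0 J' : 0 <= p ^+ (2 * #|E0|) * eps * (#|V|%:R ^+ #|finset.cover J'| *
       [forall z in finset.cover J', psi z \in [set phi z | z : Z]]%:R) :> R.
  by rewrite !mulr_ge0 // exprn_ge0.
rewrite cardU; have [J0|Jn0] := eqVneq J finset.set0.
  by rewrite J0 cards0 subn0 lerDl sumr_ge0.
have leJ : (#|J| <= 2 * #|E0|)%N.
  by rewrite (leq_trans (subset_leq_card JE)) // leq_pmull.
rewrite (bigD1 J) //= addrA addrAC ler_wpDl ?addr_ge0 ?exprn_ge0 ?sumr_ge0 //.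
have -> : [forall z in finset.cover J, psi z \in [set phi z | z : Z]].
  apply/forallP => z; apply/implyP => /bigcupP[e]; rewrite inE => /andP[_].
  case/imsetP => e' _ ee' ze; have : psi z \in phi @: e' by rewrite -ee' imset_f.
  by case/imsetP => y _ ->; rewrite imset_f.
rewrite mulr1 -mulrA -{2}(subnK leJ) exprD -mulrA ler_peMr ?exprn_ge0 //.
by rewrite mulrC hJ.
Qed.

(** Chebyshev's inequality for the number [X] of maps in [Phi] whose image of [E0] is present. The
    mean is [M], and the overlap bound gives variance at most [M ^+ 2 * (N * eps)]. *)
Lemma gnp_second_moment (R : realType) (Z V : finType) (E0 : {set {set Z}})
    (Phi : {set {ffun Z -> V}}) (p c eps : R) :
  0 <= p <= 1 -> (0 < #|V|)%N -> E0 \subset all_edges Z ->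
  (forall phi, phi \in Phi -> injective phi) ->
  0 < c -> c * #|V|%:R ^+ #|Z| <= #|Phi|%:R -> 0 <= eps ->
  (forall J : {set {set Z}}, J \subset E0 -> J != finset.set0 ->
     1 <= eps * #|V|%:R ^+ #|finset.cover J| * p ^+ #|J|) ->
  1 - (#|{set {set Z}}|%:R * #|Z|.+1%:R ^+ #|Z| / c) * eps <=
    gnp_prob p (fun E : sgraph V =>
      exists2 phi, phi \in Phi & edge_image E0 phi \subset edges E).
Proof.
move=> p01 V0 E0Z Phi_inj c0 hPhi eps0 hJ.
have p0 : 0 <= p by case/andP: p01.
set Q := fun E => _; set N : R := _ * _ / c.
set n : R := #|V|%:R in hPhi hJ *.
have n0 : 0 < n by rewrite ltr0n.
have Phi0 : 0 < #|Phi|%:R :> R by apply: lt_le_trans hPhi; rewrite mulr_gt0 ?exprn_gt0.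
pose w E : R := @gnp_weight R V p E.
have w0 E : 0 <= w E by apply: gnp_weight_ge0.
pose X E : R := \sum_(phi in Phi) (edge_image E0 phi \subset edges E)%:R.
have wS (S : {set {set V}}) : S \subset all_edges V ->
    \sum_E w E * (S \subset edges E)%:R = p ^+ #|S|.
  move=> SV; rewrite -(gnp_weight_superset p SV) [RHS]big_mkcond /=.
  by apply: eq_bigr => E _; case: ifP; rewrite ?mulr1 ?mulr0.
set e := #|E0| in hJ *; pose M : R := #|Phi|%:R * p ^+ e.
(* For nonempty [E0], the hypothesis on [J] applied to [E0] itself rules out [p ^+ e = 0]. *)
have pe0 : 0 < p ^+ e.
  rewrite lt_neqAle exprn_ge0 // andbT eq_sym.
  have [E00|En0] := eqVneq E0 finset.set0; first by rewrite /e E00 cards0 oner_eq0.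
  have := hJ _ (subxx _) En0; apply: contraTneq => ->.
  by rewrite mulr0 -ltNge ltr01.
have M0 : 0 < M by rewrite mulr_gt0.
have EX : \sum_E w E * X E = M.
  under eq_bigr do rewrite mulr_sumr.
  rewrite exchange_big /= /M mulr_natl -sumr_const.
  apply: eq_bigr => phi Pphi; rewrite wS ?edge_image_sub //; last exact: Phi_inj.
  by rewrite card_edge_image //; apply: Phi_inj.
have EX2 : \sum_E w E * X E ^+ 2 =
    \sum_(phi in Phi) \sum_(psi in Phi) p ^+ #|edge_image E0 phi :|: edge_image E0 psi|.
  transitivity (\sum_E \sum_(phi in Phi) \sum_(psi in Phi)
      w E * (edge_image E0 phi :|: edge_image E0 psi \subset edges E)%:R).
    apply: eq_bigr => E _; rewrite expr2 {1}/X mulr_suml mulr_sumr.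
    apply: eq_bigr => phi _; rewrite /X !mulr_sumr; apply: eq_bigr => psi _.
    by rewrite finset.subUset -mulnb natrM.
  rewrite exchange_big; apply: eq_bigr => phi Pphi; rewrite exchange_big.
  apply: eq_bigr => psi Ppsi; rewrite wS // finset.subUset !edge_image_sub //;
  exact: Phi_inj.
have sumPhi (x : R) : \sum_(phi in Phi) x = #|Phi|%:R * x.
  by rewrite sumr_const mulr_natl.
have var_le : \sum_E w E * (X E - M) ^+ 2 <= M ^+ 2 * (N * eps).
  rewrite (eq_bigr (fun E => w E * X E ^+ 2 - 2 * M * (w E * X E) + M ^+ 2 * w E)); last first.
    by move=> E _; ring.
  rewrite big_split /= sumrB -!mulr_sumr EX EX2 (gnp_weight_total V p) mulr1.
  apply: le_trans (_ : \sum_(phi in Phi) \sum_(psi in Phi) (p ^+ (2 * e) +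
     \sum_(J : {set {set Z}}) p ^+ (2 * e) * eps * (n ^+ #|finset.cover J| *
       [forall z in finset.cover J, psi z \in [set phi z | z : Z]]%:R)) - M ^+ 2 <= _).
    rewrite (_ : _ - 2 * M * M + _ = \sum_(phi in Phi) \sum_(psi in Phi)
      p ^+ #|edge_image E0 phi :|: edge_image E0 psi| - M ^+ 2); last by ring.
    rewrite lerD2r; apply: ler_sum => phi Pphi; apply: ler_sum => psi Ppsi.
    by apply: edge_image_overlap => //; apply: Phi_inj.
  rewrite (_ : \sum_(phi in Phi) _ = M ^+ 2 + \sum_(phi in Phi) \sum_(psi in Phi)
     \sum_(J : {set {set Z}}) p ^+ (2 * e) * eps * (n ^+ #|finset.cover J| *
       [forall z in finset.cover J, psi z \in [set phi z | z : Z]]%:R)); last first.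
    under eq_bigr => phi _ do rewrite big_split /= sumPhi.
    rewrite big_split /= sumPhi /M; congr (_ + _).
    by rewrite mulnC exprM exprMn (expr2 #|Phi|%:R) mulrA.
  rewrite addrAC subrr add0r.
  apply: le_trans (_ : \sum_(phi in Phi) p ^+ (2 * e) * eps *
     (#|{set {set Z}}|%:R * (#|Z|.+1%:R ^+ #|Z| * n ^+ #|Z|)) <= _).
    apply: ler_sum => phi _; rewrite exchange_big /=.
    rewrite mulr_natl -sumr_const mulr_sumr; apply: ler_sum => J _.
    rewrite -mulr_sumr; apply: ler_wpM2l; first by rewrite mulr_ge0 ?exprn_ge0.
    rewrite -mulr_sumr.
    (* The image of [phi] has at most [#|Z|] points; the base [#|Z|.+1] is at least 1 even when [Z]
       is empty. *)
    apply: le_trans (weighted_count_ffun_into (finset.cover J) (C := [set phi z | z : Z]) _ _).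
    - rewrite ler_wpM2l ?exprn_ge0 //.
      by rewrite [leRHS](bigID (mem Phi)) /= lerDl sumr_ge0.
    - by rewrite ler_nat (leq_trans (leq_imset_card _ _)).
    - by rewrite ler1n.
  (* Used with [y] the size of [Phi], [x = n ^+ #|Z|] and [b = c^-1]: the density of [Phi] trades
     the number of all maps for [#|Phi| / c]. *)
  have aux (y q K L x a b : R) : 0 <= y -> 0 <= q -> 0 <= K -> 0 <= L -> 0 <= a ->
      x <= y * b -> y * (q * a * (K * (L * x))) <= (y ^+ 2 * q) * (K * L * b * a).
    move=> y0 q0 K0 L0 a0 xy.
    have -> : y ^+ 2 * q * (K * L * b * a) = y * (q * a * (K * (L * (y * b)))) by ring.
    by rewrite !ler_wpM2l // mulr_ge0.
  rewrite sumPhi /M exprMn -exprM mulnC /N; apply: aux => //.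
  - by apply: exprn_ge0.
  - by rewrite ler_pdivlMr // mulrC.
(* Where [Q] fails, [X] is 0 and its squared deviation is exactly [M ^+ 2]. *)
have fail_le : \sum_(E | ~~ `[< Q E >]) w E <= N * eps.
  have M20 : 0 < M ^+ 2 by rewrite exprn_gt0.
  rewrite -(ler_pM2l M20); apply: le_trans var_le.
  rewrite [leRHS](bigID (fun E => `[< Q E >])) /= ler_wpDl ?sumr_ge0 //.
    by move=> E _; rewrite mulr_ge0 ?sqr_ge0.
  rewrite mulr_sumr; apply: ler_sum => E /asboolPn nQ.
  suff -> : X E = 0 by rewrite sub0r sqrrN mulrC.
  rewrite /X big1 // => phi Pphi; case: (boolP (_ \subset _)) => // h.
  by case: nQ; exists phi.
rewrite lerBlDr -(gnp_weight_total V p) (bigID (fun E => `[< Q E >])) /=.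
by rewrite lerD2l.
Qed.

(** * Degrees and densities *)

Definition adjacent {V : finType} (G : sgraph V) : rel V :=
  fun u v => [set u; v] \in edges G.

Lemma adjacent_sym (V : finType) (G : sgraph V) : symmetric (adjacent G).
Proof. by move=> u v; rewrite /adjacent finset.setUC. Qed.

Lemma min_degree_le (V : finType) (G : sgraph V) (v : V) :
  (min_degree G <= degree G v)%N.
Proof.
rewrite /min_degree; have := mem_index_enum v.
elim: (index_enum V) => // a s IH; rewrite inE big_cons => /predU1P[<-|vs].
  exact: geq_minl.
by rewrite geq_min IH ?orbT.
Qed.

Lemma degree_le (V : finType) (G : sgraph V) (v : V) :
  (degree G v <= #|[set u | adjacent G v u]|)%N.
Proof.
apply: leq_trans (leq_imset_card (fun u => [set v; u]) _); apply: subset_leq_card.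
apply/fintype.subsetP => e; rewrite inE => /andP[eG ve].
have /cards2P[x [y [xy exy]]] : #|e| == 2%N.
  by have := fintype.subsetP (edgesP G) _ eG; rewrite inE.
have [u eu] : exists u, e = [set v; u].
  by move: ve; rewrite exy !inE => /orP[]/eqP ->; [exists y|exists x; rewrite finset.setUC].
by apply/imsetP; exists u; rewrite // inE /adjacent -eu.
Qed.

Lemma nonadjacent_le (R : realFieldType) (V : finType) (G : sgraph V) (alpha : R) v :
  alpha * #|V|%:R <= (min_degree G)%:R ->
  #|nonadjacent (adjacent G) v|%:R <= (1 - alpha) * #|V|%:R.
Proof.
move=> hG; rewrite (_ : nonadjacent _ v = ~: [set u | adjacent G v u]); last first.
  by apply/setP => u; rewrite !inE.
rewrite cardsCs finset.setCK natrB ?max_card // mulrBl mul1r lerD2l lerN2.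
by apply: le_trans hG _; rewrite ler_nat (leq_trans (min_degree_le G v)) ?degree_le.
Qed.

Lemma max_density_ge0 (R : realType) (T : finType) (H : sgraph T) P :
  0 <= max_density R H P.
Proof. exact: bigmax_ge_id. Qed.

Lemma max_density_mono (R : realType) (T : finType) (H : sgraph T) (P Q : {set T}) :
  P \subset Q -> max_density R H P <= max_density R H Q.
Proof.
move=> PQ; apply: bigmax_le => [|X /andP[/and3P[XP XH XX] X0]].
  exact: max_density_ge0.
apply: (le_bigmax_cond _ (fun X : {set T} * {set {set T}} => #|X.2|%:R / #|X.1|%:R)).
by rewrite X0 /subgraph_of_induced (fintype.subset_trans XP PQ) XH XX.
Qed.

Lemma partite_density_attained (R : realType) (T : finType) (r : nat) (H : sgraph T) :
  (0 < r)%N -> exists f : {ffun T -> 'I_r}, forall i,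
    max_density R H [set v | f v == i] <= partite_density R r H.
Proof.
case: r => // r _.
(* Since [0 < r], a colouring exists; the default value is at least every term, so the minimum is
   attained at a colouring. *)
rewrite /partite_density (bigmin_eq_arg _ [ffun=> ord0]) //; last first.
  move=> f _; apply: bigmax_le => [|i _]; first exact: max_density_ge0.
  exact/max_density_mono/finset.subsetT.
set f := [arg min_(_ < _) _]%O; exists f => i.
exact: (le_bigmax _ (fun i => max_density R H [set v | f v == i])).
Qed.

Lemma max_density_cover (R : realType) (T : finType) (H : sgraph T) (P : {set T})
    (J : {set {set T}}) :
  J \subset edges H -> finset.cover J \subset P ->
  #|J|%:R <= max_density R H P * #|finset.cover J|%:R.
Proof.
(* An empty cover forces [J] to be empty, as edges are nonempty; otherwise the subgraph with vertex
   set [cover J] and edge set [J] competes in the maximum. *)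
move=> JH JP; have [/cards0_eq c0|c0] := posnP #|finset.cover J|.
  rewrite c0 cards0 mulr0 lern0 cards_eq0; apply/set0Pn => -[e eJ].
  have [t te] := edge_neq0 (fintype.subsetP JH e eJ).
  have : t \in finset.cover J by apply/bigcupP; exists e.
  by rewrite c0 inE.
rewrite -ler_pdivrMr ?ltr0n //.
apply: (le_bigmax_cond _ (fun X : {set T} * {set {set T}} => #|X.2|%:R / #|X.1|%:R)
  (j := (finset.cover J, J))).
rewrite c0 andbT /subgraph_of_induced JP JH /=.
by apply/fintype.subsetP => e eJ; rewrite inE; apply: (finset.bigcup_sup e).
Qed.

(** All copies are coloured alike, [(k, t)] receiving colour [f t]. These are the edges that the
    random graph has to supply. *)
Definition mono_copies_edges {T K : finType} {r : nat} (H : sgraph T)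
    (f : {ffun T -> 'I_r}) : {set {set K * T}} :=
  [set e in copies_edges K H | [exists i, [forall z in e, f z.2 == i]]].

Lemma copies_edges_sub (T K : finType) (H : sgraph T) :
  copies_edges K H \subset all_edges _.
Proof.
apply/fintype.subsetP => _ /imsetP[[k e] /finset.setXP[_ eH] ->] /=.
rewrite inE card_imset => [|x y []//].
by have := fintype.subsetP (edgesP H) e eH; rewrite inE.
Qed.

Lemma mono_copies_edges_sub (T K : finType) (r : nat) (H : sgraph T)
    (f : {ffun T -> 'I_r}) :
  mono_copies_edges (K := K) H f \subset all_edges _.
Proof.
apply: fintype.subset_trans (copies_edges_sub K H).
by apply/fintype.subsetP => e; rewrite inE => /andP[].
Qed.

(* Split a set of monochromatic edges by copy and colour; each piece lives in
   one [H[P_i]], and the pieces have disjoint supports. *)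
Lemma mono_copies_sparse (R : realType) (T K : finType) (r : nat) (H : sgraph T)
    (f : {ffun T -> 'I_r}) (m : R) (J : {set {set K * T}}) :
  (forall i, max_density R H [set v | f v == i] <= m) ->
  J \subset mono_copies_edges H f -> #|J|%:R <= m * #|finset.cover J|%:R.
Proof.
move=> hm JE; pose B (c : K * 'I_r) := [set z : K * T | (z.1 == c.1) && (f z.2 == c.2)].
have JcE e : e \in J -> exists k e', [/\ e = pair k @: (e' : {set T}), e' \in edges H &
    exists i, forall t, t \in e' -> f t = i].
  move=> /(fintype.subsetP JE); rewrite inE => /andP[/imsetP[[k e'] /finset.setXP[_ e'H] /= ->]].
  move=> /existsP[i /forallP hi]; exists k, e'; split => //; exists i => t te.
  by apply/eqP; have := hi (k, t); rewrite imset_f.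
have cardJ : (#|J| <= \sum_c #|[set e in J | e \subset B c]|)%N.
  rewrite -sum1_card (eq_bigr (fun c => \sum_(e in J) (e \subset B c : nat)%N)); last first.
    move=> c _; rewrite -sum1_card big_mkcond [RHS]big_mkcond /=.
    by apply: eq_bigr => e _; rewrite inE; case: (e \in J); case: (e \subset B c).
  rewrite exchange_big /=; apply: leq_sum => e /JcE[k [e' [-> e'H [i hi]]]].
  rewrite (bigD1 (k, i)) //= (_ : _ \subset _) //.
  by apply/fintype.subsetP => _ /imsetP[t te ->]; rewrite inE /= eqxx (hi _ te) /=.
have cardC : #|finset.cover J| = (\sum_c #|finset.cover J :&: B c|)%N.
  rewrite -sum1_card (eq_bigr (fun c => \sum_(z in finset.cover J) (z \in B c : nat)%N)); last first.
    move=> c _; rewrite -sum1_card big_mkcond [RHS]big_mkcond /=.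
    by apply: eq_bigr => z _; rewrite inE; case: (z \in _); case: (z \in B c).
  rewrite exchange_big /=; apply: eq_bigr => z _.
  rewrite (bigD1 (z.1, f z.2)) //= inE /= !eqxx big1 // => -[k i] ne.
  apply/eqP; rewrite eqb0 inE /=; apply: contra ne => /andP[/eqP -> /eqP ->].
  exact: eqxx.
apply: le_trans (_ : (\sum_c #|[set e in J | e \subset B c]|)%N%:R <= _).
  by rewrite ler_nat.
rewrite cardC !natr_sum mulr_sumr; apply: ler_sum => -[k i] _.
(* The piece of [J] in copy [k] and colour [i], pulled back to [H], where [max_density] can be
   applied. *)
pose J' := [set e in edges H | (pair k @: (e : {set T}) \in J) && (e \subset [set v | f v == i])].
apply: le_trans (_ : #|J'|%:R <= _).
  rewrite ler_nat; apply: leq_trans (leq_imset_card (fun e : {set T} => pair k @: e) _).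
  apply: subset_leq_card; apply/fintype.subsetP => e; rewrite inE => /andP[eJ eB].
  have [k' [e' [ee e'H _]]] := JcE e eJ.
  have [t te] := edge_neq0 e'H.
  have kk : k' = k.
    have /(fintype.subsetP eB) : (k', t) \in e by rewrite ee imset_f.
    by rewrite inE => /andP[/eqP].
  rewrite kk in ee; apply/imsetP; exists e' => //.
  rewrite inE e'H -ee eJ /=; apply/fintype.subsetP => s se.
  have /(fintype.subsetP eB) : (k, s) \in e by rewrite ee imset_f.
  by rewrite !inE => /andP[].
have J'H : J' \subset edges H by apply/fintype.subsetP => e; rewrite inE => /andP[].
have J'i : finset.cover J' \subset [set v | f v == i].
  by apply/bigcupsP => e; rewrite inE => /and3P[].
apply: le_trans (max_density_cover R J'H J'i) _; apply: ler_pM => //.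
  exact: max_density_ge0.
rewrite ler_nat -(card_imset (mem (finset.cover J')) (f := pair k)); last by move=> x y [].
apply: subset_leq_card; apply/fintype.subsetP => _ /imsetP[t + ->].
case/bigcupP => e; rewrite inE => /and3P[_ keJ /fintype.subsetP ei] te.
have kt : (k, t) \in finset.cover J.
  by apply/bigcupP; exists (pair k @: e) => //; apply: imset_f.
by have := ei t te; rewrite !inE /= eqxx kt => ->.
Qed.

(** * Combining the dense graph with the random edges *)

Lemma gnp_prob_mono (R : realType) (V : finType) (p : R) (P Q : sgraph V -> Prop) :
  0 <= p <= 1 -> (forall E, P E -> Q E) -> gnp_prob p P <= gnp_prob p Q.
Proof.
move=> p01 PQ; rewrite /gnp_prob [leRHS](bigID (fun E => `[< P E >])) /=.
rewrite [X in _ <= X + _](eq_bigl (fun E => `[< P E >])); last first.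
  move=> E; case: (asboolP (P E)) => [PE|_]; rewrite ?andbF //.
  by rewrite andbT; apply/asboolP/PQ.
by rewrite lerDl sumr_ge0 // => E _; apply: (gnp_weight_ge0 E p01).
Qed.

(** Monochromatic edges of the copies are mapped into [E] and bichromatic ones into [G], so the
    board contains all the copies. *)
Lemma waiter_wins_of_partite_hom (T V : finType) (r : nat) (H : sgraph T)
    (f : {ffun T -> 'I_r}) (G E : sgraph V)
    (phi : {ffun 'I_(2 ^ #|edges H|) * T -> V}) :
  injective phi -> partite_hom (fun z => f z.2) (adjacent G) phi ->
  edge_image (mono_copies_edges H f) phi \subset edges E ->
  waiter_wins H (edges G :|: edges E).
Proof.
move=> phi_inj /forallP hom /fintype.subsetP EE; apply: (waiter_wins_copies phi_inj) => e eC.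
rewrite inE; case: (boolP (e \in mono_copies_edges H f)) => [eM|].
  by rewrite EE ?orbT //; apply/imsetP; exists e.
rewrite inE eC /= negb_exists => /forallP nmono.
have /cards2P[y [z [_ eyz]]] : #|e| == 2%N.
  by have := fintype.subsetP (copies_edges_sub _ H) e eC; rewrite inE.
have fyz : f y.2 != f z.2.
  apply: contra (nmono (f y.2)) => /eqP yz; apply/forallP => x; apply/implyP.
  by rewrite eyz !inE => /orP[]/eqP -> //; rewrite yz.
have := implyP (forallP (hom y) z) fyz; rewrite /adjacent => adj_yz.
by rewrite eyz imsetU1 imset_set1 adj_yz.
Qed.

(** All homomorphisms together have density at least [2 * c]. The non-injective maps have density at
    most [#|Z| ^ 2 / #|V|], which the last hypothesis bounds by [c]. *)
Lemma many_injective_partite_homs (R : realType) (Z V : finType) (r : nat)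
    (f : Z -> 'I_r) (G : sgraph V) (alpha c : R) :
  (0 < #|V|)%N -> alpha <= 1 -> 0 <= 1 - r.-1%:R * (1 - alpha) ->
  alpha * #|V|%:R <= (min_degree G)%:R ->
  c = ((1 - r.-1%:R * (1 - alpha)) ^+ r) ^+ (2 ^ #|Z|) / 2 ->
  #|Z|%:R ^+ 2 <= c * #|V|%:R ->
  c * #|V|%:R ^+ #|Z| <=
    #|[set phi : {ffun Z -> V} | injectiveb phi && partite_hom f (adjacent G) phi]|%:R.
Proof.
move=> V0 a1 d0 hG cE hn; set Phi := finset _; set n : R := #|V|%:R in hn *.
have n0 : 0 < n by rewrite ltr0n.
have b0 : 0 <= 1 - alpha by rewrite subr_ge0.
have hom := partite_hom_density f (@adjacent_sym V G) V0
  (fun v => nonadjacent_le v hG) b0 d0 (lexx _).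
have noninj := @sum_noninjective R Z V V0.
rewrite -(ler_pM2l n0).
have PhiE : \sum_(phi : {ffun Z -> V}) (partite_hom f (adjacent G) phi)%:R <=
    #|Phi|%:R + \sum_(phi : {ffun Z -> V}) (~~ injectiveb phi)%:R :> R.
  rewrite -sum1_card natr_sum [X in _ <= X + _]big_mkcond -big_split /=; apply: ler_sum => phi _.
  rewrite inE; case: (injectiveb phi); case: (partite_hom _ _ _);
  by rewrite /= ?addr0 ?add0r ?ler01.
have {}hom := le_trans hom PhiE; rewrite -/n -(ler_pM2l n0) in hom.
have {}hn : #|Z|%:R ^+ 2 * n ^+ #|Z| <= n * (c * n ^+ #|Z|).
  by rewrite mulrA (mulrC n) ler_wpM2r ?exprn_ge0 // ltW.
have cE2 : ((1 - r.-1%:R * (1 - alpha)) ^+ r) ^+ (2 ^ #|Z|) = 2 * c.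
  by rewrite cE; field.
rewrite cE2 mulrDr in hom.
have := le_trans noninj hn; rewrite -/n => {}noninj.
have := le_trans hom (lerD (lexx _) noninj).
rewrite -lerBlDr; apply: le_trans; rewrite le_eqVlt; apply/orP; left.
by apply/eqP; ring.
Qed.

(** From [j <= m * v] one gets [n ^ v * n ^ (- j / m) >= 1], and [eps * p] is at least
    [n ^ (- 1 / m)]. Finally [eps ^ j <= eps], since [0 < j] and [eps <= 1]. The case [m = 0], where
    the threshold is read as 0, cannot occur with [0 < j]. *)
Lemma hitting_condition (R : realType) (n : nat) (m p eps : R) (v j : nat) :
  (0 < n)%N -> 0 <= p -> 0 < eps <= 1 -> (0 < j)%N -> j%:R <= m * v%:R ->
  (if m == 0 then 0 else n%:R `^ (- m^-1)) <= eps * p ->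
  1 <= eps * n%:R ^+ v * p ^+ j.
Proof.
move=> n0 p0 /andP[eps0 eps1] j0 jm; have n1 : 1 <= n%:R :> R by rewrite ler1n.
have jR0 : 0 < j%:R :> R by rewrite ltr0n.
have m0 : 0 < m.
  have := lt_le_trans jR0 jm; case: (ltrgt0P m) => // [mn|->]; last by rewrite mul0r ltxx.
  by rewrite ltNge mulr_le0_ge0 // ltW.
rewrite gt_eqF // => thr.
have nn0 : 0 < n%:R :> R by rewrite ltr0n.
have t0 : 0 <= n%:R `^ (- m^-1) by apply: powR_ge0.
apply: le_trans (_ : n%:R ^+ v * (n%:R `^ (- m^-1)) ^+ j <= _).
  rewrite -powR_mulrn ?ler0n // -powR_mulrn // -powRrM -powRD; last first.
    by apply/implyP => _; rewrite gt_eqF.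
  rewrite -[leLHS](powRr0 n%:R) ler_powR // mulNr subr_ge0.
  by rewrite mulrC ler_pdivrMr // mulrC.
apply: le_trans (_ : n%:R ^+ v * (eps * p) ^+ j <= _).
  rewrite ler_wpM2l ?exprn_ge0 ?ler0n // lerXn2r ?nnegrE //.
  by rewrite mulr_ge0 // ltW.
rewrite exprMn mulrCA -mulrA; apply: ler_wpM2r.
  by rewrite mulr_ge0 // exprn_ge0.
by rewrite -[leRHS]expr1 ler_wiXn2l // ltW.
Qed.

Local Open Scope classical_set_scope.
Local Open Scope ring_scope.

Theorem theorem1p8 (R : realType) (r : nat) (alpha : R)
    (T : finType) (H : sgraph T)
    (G : forall n : nat, sgraph 'I_n) (p : nat -> R)
    (hr : (2 <= r)%N)
    (halpha : (r%:R - 2) / (r%:R - 1) < alpha <= (r%:R - 1) / r%:R)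
    (hG : \forall n \near \oo, alpha * n%:R <= (min_degree (G n))%:R)
    (hp01 : forall n : nat, 0 <= p n <= 1)
    (hp : threshold R r H =o_\oo p) :
  gnp_prob (p n) (fun E => waiter_wins H (edges (G n) :|: edges E)%SET)
    @[n --> \oo] --> (1 : R).
Proof.
have r0 : (0 < r)%N by apply: leq_trans hr.
have rR0 : 0 < r%:R :> R by rewrite ltr0n.
have rE : r.-1%:R = r%:R - 1 :> R by rewrite -subn1 natrB.
have r10 : 0 < r%:R - 1 :> R by rewrite -rE ltr0n -ltnS prednK.
have [lo hi] := andP halpha.
have a1 : alpha <= 1 by apply: le_trans hi _; rewrite ler_pdivrMr // mul1r gerBl.
(* The lower bound on [alpha] says exactly that the greedy choice of an [r]-clique never runs out of
   vertices. *)
have d0 : 0 < 1 - r.-1%:R * (1 - alpha).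
  by rewrite ltr_pdivrMr // in lo; rewrite rE; lra.
have [f hf] := partite_density_attained R H r0.
pose Z : finType := ('I_(2 ^ #|edges H|) * T)%type.
pose c : R := ((1 - r.-1%:R * (1 - alpha)) ^+ r) ^+ (2 ^ #|Z|) / 2.
have c0 : 0 < c by rewrite divr_gt0 // !exprn_gt0.
(* [C * eps] is the failure probability allowed by the second moment bound. *)
pose C : R := #|{set {set Z}}|%:R * #|Z|.+1%:R ^+ #|Z| / c.
have C0 : 0 <= C by rewrite divr_ge0 ?mulr_ge0 ?exprn_ge0 // ltW.
apply/cvgrPdist_le => e e0.
(* The cap 1 serves [hitting_condition]; [C + 1] keeps the denominator positive. *)
pose eps : R := Num.min 1 (e / (C + 1)).
have C10 : 0 < C + 1 by rewrite ltr_wpDl.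
have eps01 : 0 < eps <= 1 by rewrite lt_min ltr01 divr_gt0 //= ge_min lexx.
have Ceps : C * eps <= e.
  apply: le_trans (_ : (C + 1) * (e / (C + 1)) <= _).
    by apply: ler_pM; rewrite ?lerDl ?ge_min ?lexx ?orbT //; case/andP: eps01 => /ltW.
  by rewrite mulrCA divff ?mulr1 // gt_eqF.
have thr : \forall n \near \oo, `|threshold R r H n| <= eps * `|p n|.
  by move/eqoP: hp; apply; case/andP: eps01.
have large : \forall n \near \oo, #|Z|%:R ^+ 2 / c <= n%:R :> R by exact: nbhs_infty_ger.
near=> n.
have n0 : (0 < n)%N by near: n; exact: nbhs_infty_gt.
have [pn0 pn1] := andP (hp01 n).
rewrite ger0_norm ?subr_ge0 ?gnp_prob_le1 // lerBlDr -lerBlDl.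
apply: le_trans (_ : 1 - C * eps <= _); first by rewrite lerD2l lerN2.
have cV : #|'I_n| = n by rewrite card_ord.
pose Phi := [set phi : {ffun Z -> 'I_n} |
  injectiveb phi && partite_hom (fun z => f z.2) (adjacent (G n)) phi]%SET.
have Phi_inj phi : phi \in Phi -> injective phi by rewrite inE => /andP[/injectiveP].
apply: (@le_trans _ _ (gnp_prob (p n) (fun E : sgraph 'I_n =>
  exists2 phi, phi \in Phi & edge_image (mono_copies_edges H f) phi \subset edges E))).
  apply: gnp_second_moment => //.
  - by rewrite cV.
  - exact: mono_copies_edges_sub.
  - apply: (@many_injective_partite_homs _ _ _ _ _ _ alpha) => //.
    + by rewrite cV.
    + exact: ltW.
    + by rewrite cV; near: n.
    + by rewrite cV mulrC -ler_pdivrMr //; near: n.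
  - by case/andP: eps01 => /ltW.
  - move=> J JE J0; rewrite cV; apply: hitting_condition => //.
    + by rewrite card_gt0.
    + exact: mono_copies_sparse hf JE.
    + suff : `|threshold R r H n| <= eps * `|p n|.
        by rewrite (ger0_norm pn0) => h; apply: le_trans h; apply: ler_norm.
      by near: n.
apply: gnp_prob_mono => // E [phi]; rewrite inE => /andP[/injectiveP phi_inj hom] EE.
exact: waiter_wins_of_partite_hom phi_inj hom EE.
Unshelve. all: by end_near.
Qed.
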